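(* Let $T$ be a $k$-hypertournament with $n$ vertices, where $3\leq k\leq n-1$, and let $i\geq 1$, $j\geq 2$ be integers. Then $C_{i,j}(T)=C_{1,2}(T)$.
   Context: Given integers $n\geq k>1$, a $k$-hypertournament on $n$ vertices is a pair $T=(V,A)$ where $|V|=n$ and $A$ is a set of $k$-tuples of distinct vertices (arcs) such that for every $k$-subset $S$ of $V$, $A$ contains exactly one of the $k!$ $k$-tuples whose entries are the elements of $S$. A path in $T$ is a sequence $v_1a_1v_2a_2\cdots a_{t-1}v_t$ of distinct vertices $v_1,\dots,v_t$ ($t\geq1$) and distinct arcs $a_1,\dots,a_{t-1}$ such that $v_i$ precedes $v_{i+1}$ in $a_i$; its length $l(\cdot)$ is the number $t-1$ of arcs, and it is an $(x,y)$-path if $v_1=x$, $v_t=y$. For integers $i,j\geq1$, the $(i,j)$-step competition graph $C_{i,j}(T)$ is the graph on $V(T)$ in which $xy$ is an edge if and only if there exist a vertex $z\neq x,y$, an $(x,z)$-path $P$ and a $(y,z)$-path $Q$ such that: $y\notin V(P)$ and $x\notin V(Q)$; either ($l(P)\leq i$ and $l(Q)\leq j$) or ($l(Q)\leq i$ and $l(P)\leq j$); and $P$, $Q$ have no arc in common. *)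

(* Defs.v *)
From mathcomp Require Import all_boot.
From mathcomp Require Import boolp.

Set Implicit Arguments.
Unset Strict Implicit.
Unset Printing Implicit Defensive.

Record hypertournament (k : nat) (V : finType) := Hypertournament {
  arcs : {set k.-tuple V};
  hyp_size : 1 < k <= #|V|;
  arcs_uniq : forall a : k.-tuple V, a \in arcs -> uniq a;
  arcs_ex1 : forall S : {set V}, #|S| = k ->
    exists! a : k.-tuple V, a \in arcs /\ [set v in a] = S
}.

Record sgraph (V : finType) := SGraph {
  adj : rel V;
  adj_sym : symmetric adj;
  adj_irrefl : irreflexive adj
}.

Lemma sgraph_eq (V : finType) (G H : sgraph V) : adj G =2 adj H -> G = H.
Proof.
case: G H => [g gs gi] [h hs hi] /= eq_gh.
have e : g = h by apply/funext => x; apply/funext => y; apply: eq_gh.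
by case: _ / e hs hi => hs hi; congr SGraph; apply: Prop_irrelevance.
Qed.

Section Paths.

Variables (k : nat) (V : finType) (T : hypertournament k V).

Definition precedes (a : k.-tuple V) (v w : V) : bool :=
  [&& v \in a, w \in a & index v a < index w a].

(* The alternating sequence v_1 a_1 v_2 ... a_(t-1) v_t is encoded by its     *)
(* first vertex v_1 and the list p = [:: (a_1, v_2); ...; (a_(t-1), v_t)], so *)
(* that its length is size p.                                                 *)
Definition steps := seq (k.-tuple V * V).

Definition path_vertices (x : V) (p : steps) : seq V := x :: unzip2 p.

Definition path_arcs (p : steps) : seq (k.-tuple V) := unzip1 p.

Fixpoint is_walk (x : V) (p : steps) : bool :=
  if p is (a, v) :: p' then
    [&& a \in arcs T, precedes a x v & is_walk v p']
  else true.

Definition is_path (x y : V) (p : steps) : bool :=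
  [&& is_walk x p, uniq (path_vertices x p), uniq (path_arcs p)
    & last x (unzip2 p) == y].

Definition competes (i j : nat) (x y : V) : Prop :=
  exists (z : V) (P Q : steps),
    [/\ z <> x /\ z <> y,
        is_path x z P /\ is_path y z Q,
        y \notin path_vertices x P /\ x \notin path_vertices y Q,
        (size P <= i /\ size Q <= j) \/ (size Q <= i /\ size P <= j)
      & forall a, a \in path_arcs P -> a \notin path_arcs Q].

Lemma competes_sym i j x y : competes i j x y -> competes i j y x.
Proof.
case=> z [P [Q [[zx zy] [Px Qy] [yP xQ] [] [l1 l2] dPQ]]];
  exists z, Q, P; split=> //; try by [left | right];
  by move=> a aQ; apply/negP => /dPQ; rewrite aQ.
Qed.

Lemma competes_irrefl i j x : ~ competes i j x x.
Proof. by case=> z [P [Q [_ _ [+ _] _ _]]]; rewrite mem_head. Qed.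

Fact competes_asbool_sym i j : symmetric (fun x y => `[< competes i j x y >]).
Proof. by move=> x y; apply/asboolP/asboolP; apply: competes_sym. Qed.

Fact competes_asbool_irrefl i j :
  irreflexive (fun x y => `[< competes i j x y >]).
Proof. by move=> x; apply/asboolP; apply: competes_irrefl. Qed.

Definition step_competition_graph (i j : nat) : sgraph V :=
  SGraph (competes_asbool_sym i j) (competes_asbool_irrefl i j).

End Paths.

(* Main.v *)
Require Import Defs.
From mathcomp Require Import all_boot.
From mathcomp Require Import boolp zify.

(** Only the first arcs matter.  If [P] starts with [x a u] and [Q] with [y b w],
    then either [u = w], or any arc [c] other than [a] and [b] that contains [u]
    and [w] orders them one way or the other, which extends [x a u] or [y b w] by
    [c] and yields paths of lengths 1 and 2.  There are at least [n - 2] arcs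
    through [u] and [w], so [c] exists when [n >= 5].  When [n = 4] the endpoint
    [z] is [u] or [w], and [c] is the second arc of whichever of [P], [Q] does
    not end at once. *)

Lemma leq_bin_diag (m r : nat) : 0 < r < m -> m <= 'C(m, r).
Proof.
elim: m r => [|m IH] [|r] //; rewrite ltnS /= binS => ltrm.
have [->|r_neq0] := eqVneq r 0; first by rewrite bin0 bin1 addn1.
have ler : m <= 'C(m, r) by apply: IH; rewrite lt0n r_neq0.
suff : 0 < 'C(m, r.+1) by lia.
by rewrite bin_gt0.
Qed.

Section Competition.

Set Implicit Arguments.
Unset Strict Implicit.

Variables (k : nat) (V : finType) (T : hypertournament k V).
Implicit Types (a b c : k.-tuple V) (x y z u v w : V) (P Q : steps k V).

Lemma competes_mono (i j i' j' : nat) x y :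
  i <= i' -> j <= j' -> competes T i j x y -> competes T i' j' x y.
Proof.
move=> lei lej [z [P [Q [zxy PQ yx sz dPQ]]]]; exists z, P, Q; split=> //.
by case: sz => -[s1 s2]; [left|right]; split; lia.
Qed.

Lemma precedes_total c u w :
  u \in c -> w \in c -> u != w -> precedes c u w || precedes c w u.
Proof.
move=> uc wc neq; rewrite /precedes uc wc /= -neq_ltn.
by apply: contra neq => /eqP /index_inj ->.
Qed.

Lemma is_path_cons {x z P} : is_path T x z P -> z != x ->
  exists a u P', [/\ P = (a, u) :: P', a \in arcs T, precedes a x u & u != x].
Proof.
case: P => [|[a u] P'] /and4P [/= wP uP _ /eqP zP]; first by rewrite zP eqxx.
move=> _; exists a, u, P'; case/and3P: wP => aT axu _; split=> //.
by case/andP: uP; rewrite inE negb_or eq_sym => /andP[].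
Qed.

Lemma competes_common_out x y u a b :
  a \in arcs T -> b \in arcs T -> a != b -> x != y -> u != x -> u != y ->
  precedes a x u -> precedes b y u -> competes T 1 2 x y.
Proof.
move=> aT bT ab xy ux uy axu byu; exists u, [:: (a, u)], [:: (b, u)].
split; [by split; apply/eqP | | | by left | ].
- by rewrite /is_path /= aT bT axu byu !inE eqxx /= ![_ == u]eq_sym ux uy.
- by rewrite /= !inE ![_ == u]eq_sym !negb_or ux uy (eq_sym y) xy.
- by move=> c; rewrite !inE => /eqP ->.
Qed.

Lemma competes_detour x y u w a b c :
  [/\ a \in arcs T, b \in arcs T & c \in arcs T] -> uniq [:: a; b; c] ->
  uniq [:: x; y; u; w] ->
  precedes a x u -> precedes b y w -> precedes c u w -> competes T 1 2 x y.
Proof.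
move=> [aT bT cT] /=; rewrite !inE !negb_or !andbT => /andP[/andP[ab ac] bc].
move=> /and3P[/and3P[xy xu xw] /andP[yu yw] uw] axu byw cuw.
exists w, [:: (a, u); (c, w)], [:: (b, w)].
split; [by split; apply/eqP; rewrite eq_sym | | | by right | ].
- rewrite /is_path /= aT bT cT axu byw cuw !inE !negb_or.
  by rewrite xu xw uw ac yw !eqxx.
- by rewrite /= !inE !negb_or (eq_sym y x) xy yu yw xw.
- by move=> d; rewrite !inE => /orP[] /eqP ->; rewrite // eq_sym.
Qed.

Lemma competes_of_third_arc x y u w a b c :
  [/\ a \in arcs T, b \in arcs T & c \in arcs T] -> uniq [:: a; b; c] ->
  uniq [:: x; y; u; w] -> precedes a x u -> precedes b y w ->
  u \in c -> w \in c -> competes T 1 2 x y.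
Proof.
move=> [aT bT cT] abc xyuw axu byw uc wc.
have uw : u != w by case/and4P: xyuw => _ _; rewrite inE.
case/orP: (precedes_total uc wc uw) => cuw.
  by apply: (competes_detour _ abc xyuw axu byw cuw).
apply/competes_sym/(competes_detour _ _ _ byw axu cuw) => //.
- by move: abc; rewrite /= !inE (eq_sym b a); do !case: (_ == _).
- by move: xyuw; rewrite /= !inE (eq_sym y x) (eq_sym w u); do !case: (_ == _).
Qed.

Lemma exists_third_arc u w a b : u != w -> 3 <= k -> k < #|V| -> 4 < #|V| ->
  exists c, [/\ c \in arcs T, c != a, c != b, u \in c & w \in c].
Proof.
move=> uw k3 kV V5.
pose B := ~: [set u; w].
have cB : #|B| = #|V| - 2 by have := cardsC [set u; w]; rewrite cards2 uw /B; lia.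
pose D := [set A : {set V} | A \subset B & #|A| == k - 2].
have cD : 2 < #|D|.
  by rewrite cards_draws; apply: leq_trans (leq_bin_diag _ _ _); lia.
pose E := [set [set v in a] :&: B; [set v in b] :&: B].
have [A AD AE] : exists2 A, A \in D & A \notin E.
  apply/subsetPn; apply/negP => /subset_leq_card; rewrite cards2; lia.
move: AD; rewrite inE => /andP[AB /eqP cA].
have cS : #|A :|: [set u; w]| = k.
  have : A :&: [set u; w] = set0.
    by apply/eqP; rewrite setI_eq0 disjoints_subset.
  rewrite cardsU => ->; rewrite cards0 cA cards2 uw; lia.
have [c [[cT cE] _]] := arcs_ex1 T cS.
have cAE : [set v in c] :&: B = A.
  by rewrite cE setIUl setICr setU0; apply/setIidPl.
exists c; split=> //.
- by apply: contraNneq AE => e; rewrite -cAE e !inE eqxx.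
- by apply: contraNneq AE => e; rewrite -cAE e !inE eqxx orbT.
- by have /setP/(_ u) := cE; rewrite !inE eqxx orbT.
- by have /setP/(_ w) := cE; rewrite !inE eqxx !orbT.
Qed.

Lemma second_arc_four x y u w b Q :
  (forall v, v \in [:: x; y; u; w]) ->
  is_path T y u ((b, w) :: Q) -> x \notin path_vertices y ((b, w) :: Q) ->
  u != w ->
  exists2 c, c \in path_arcs Q & [/\ c \in arcs T, c != b, u \in c & w \in c].
Proof.
move=> all4 Qp xQ uw; case: Q Qp xQ => [|[c t] Q].
  by case/and4P=> _ _ _ /= /eqP wu; rewrite wu eqxx in uw.
case/and4P=> /= /and5P[_ _ cT cwt _] uv ua _ xQ.
have tu : t = u.
  have := all4 t; rewrite !inE => /or4P[] /eqP // et; move: xQ uv;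
    by rewrite et !inE eqxx ?orbT ?andbF.
case/and3P: cwt => wc tc _; exists c; first exact: mem_head.
split; rewrite -?tu //.
by apply: contraTneq ua => ->; rewrite inE eqxx.
Qed.

Lemma competes_1_2 (i j : nat) x y :
  3 <= k -> k < #|V| -> competes T i j x y -> competes T 1 2 x y.
Proof.
move=> k3 kV [z [P [Q [[/eqP zx /eqP zy] [Pp Qp] [yP xQ] _ dPQ]]]].
have [a [u [P' [eP aT axu ux]]]] := is_path_cons Pp zx.
have [b [w [Q' [eQ bT byw wy]]]] := is_path_cons Qp zy.
subst P Q.
move: (yP) (xQ); rewrite !inE !negb_or => /and3P[yx yu _] /and3P[xy xw _].
have ab : a != b.
  by have := dPQ a; rewrite !inE eqxx => /(_ isT); rewrite negb_or => /andP[].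
have [uwE|uw] := eqVneq u w.
  by rewrite -uwE in byw; apply: competes_common_out axu byw; rewrite // eq_sym.
have xyuw : uniq [:: x; y; u; w].
  by rewrite /= !inE !negb_or xy (eq_sym x u) ux xw yu (eq_sym y w) wy uw.
suff [c [cT ca cb uc wc]] :
    exists c, [/\ c \in arcs T, c != a, c != b, u \in c & w \in c].
  apply: (competes_of_third_arc _ _ xyuw axu byw uc wc) => //.
  by rewrite /= !inE negb_or ab !(eq_sym _ c) ca cb.
have [V5|V4] := ltnP 4 #|V|; first exact: exists_third_arc.
have all4 v : v \in [:: x; y; u; w].
  apply: contraLR V4 => v4; rewrite -ltnNge.
  have /card_uniqP /= <- : uniq (v :: [:: x; y; u; w]).
    by rewrite cons_uniq v4 xyuw.
  exact: max_card.
have := all4 z; rewrite !inE (negPf zx) (negPf zy) /= => /orP[] /eqP ez; subst z.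
- have [c cQ [cT cb uc wc]] := second_arc_four all4 Qp xQ uw.
  exists c; split=> //; apply: contraTneq cQ => ->.
  by have := dPQ a; rewrite !inE eqxx => /(_ isT); rewrite negb_or => /andP[].
- have all4' v : v \in [:: y; x; w; u].
    by have := all4 v; rewrite !inE => /or4P[] ->; rewrite ?orbT.
  have [c cP [cT ca wc uc]] : exists2 c, c \in path_arcs P' &
      [/\ c \in arcs T, c != a, w \in c & u \in c].
    by apply: second_arc_four all4' Pp yP _; rewrite eq_sym.
  exists c; split=> //; apply/eqP => cb.
  by have := dPQ c; rewrite cb !inE eqxx -cb cP orbT => /(_ isT).
Qed.

End Competition.

Theorem theorem6p2 (k : nat) (V : finType) (T : hypertournament k V)
    (i j : nat) (hk3 : 3 <= k) (hkn : k <= #|V| - 1)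
    (hi : 1 <= i) (hj : 2 <= j) :
  step_competition_graph T i j = step_competition_graph T 1 2.
Proof.
apply: sgraph_eq => x y /=; apply/asboolP/asboolP; last exact: competes_mono.
by apply: competes_1_2; lia.
Qed.
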